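(* Let $\mathcal{G} \to X$ be a group space over $X$ and let $\mathcal{O}_X(\mathcal{G})$ be the sheaf of regular sections of $\mathcal{G}$. Then the Čech cohomology set $\check{H}^1(X, \mathcal{O}_X(\mathcal{G}))$ is in bijection with the set of isomorphism classes of $\mathcal{G}$-torsors over $X$.
   Context: The statement is understood in either of two categories: (T) topological spaces and continuous maps, where ''regular'' means continuous; (A) complex analytic manifolds and holomorphic maps, where ''regular'' means holomorphic and group spaces $p:\mathcal{G}\to X$ are required to be submersions, so that fibre products $\mathcal{G}\times_X\mathcal{G}$ exist. A space over $X$ is an object with a morphism to $X$; morphisms of spaces over $X$ commute with the maps to $X$. A group space over $X$ is a space $p : \mathcal{G} \to X$ over $X$ with morphisms of spaces over $X$, $\mu : \mathcal{G} \times_X \mathcal{G} \to \mathcal{G}$ and $\iota : \mathcal{G} \to \mathcal{G}$, and a (regular) section $\varepsilon$ of $p$, such that for each $x \in X$ the restrictions to the fibre $\mathcal{G}_x$ make it a group with multiplication $\mu_x$, inversion $\iota_x$ and neutral element $\varepsilon(x)$. It is not assumed locally trivial. A right $\mathcal{G}$-space is a space $\mathcal{P}$ over $X$ with a morphism of spaces over $X$, $\mathcal{P} \times_X \mathcal{G} \to \mathcal{P}$, $(p,g)\mapsto p\cdot g$, which restricts on each fibre to a right action of $\mathcal{G}_x$ on $\mathcal{P}_x$; morphisms of right $\mathcal{G}$-spaces are $\mathcal{G}$-equivariant morphisms over $X$. A (right) $\mathcal{G}$-torsor is a right $\mathcal{G}$-space $\mathcal{P}$ such that every $x \in X$ has an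 open neighbourhood $U$ with an isomorphism of right $\mathcal{G}|_U$-spaces $\mathcal{G}|_U \simeq \mathcal{P}|_U$, where $\mathcal{G}|_U$ acts on itself by right translations. A morphism of $\mathcal{G}$-torsors is a morphism of right $\mathcal{G}$-spaces. A Čech $1$-cocycle on an open cover $(U_i)_{i\in I}$ is a family $g_{ij} \in \mathcal{O}_X(\mathcal{G})(U_i \cap U_j)$ with $g_{ii} = \varepsilon|_{U_i}$ and $g_{ij} g_{jk} = g_{ik}$ on $U_i \cap U_j \cap U_k$. Two cocycles $(g_{ij})$, $(h_{ij})$ on the same cover are cohomologous if $h_{ij} = u_i g_{ij} u_j^{-1}$ for some $u_i \in \mathcal{O}_X(\mathcal{G})(U_i)$, and $\check{H}^1(X,\mathcal{O}_X(\mathcal{G}))$ is the direct limit over refinements of open covers of the sets of cohomology classes. *)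

(* Defs.v *)
From HB Require Import structures.
From mathcomp Require Import all_boot all_order all_algebra.
From mathcomp Require Import all_classical all_reals all_analysis.
From mathcomp Require Import complex.

Set Implicit Arguments.
Unset Strict Implicit.
Unset Printing Implicit Defensive.

Import Order.TTheory GRing.Theory Num.Theory numFieldNormedType.Exports.

Local Open Scope classical_set_scope.
Local Open Scope ring_scope.

(** * The two categories *)

(** [regular_at f x] is a local notion: it only depends on the germ of [f] at
    [x]. A regular map on an open set [U] of [X] is thus represented by a total
    function that is regular at the points of [U], with unconstrained values
    elsewhere.
    [admissible p] is the extra requirement on the structure map of a group
    space: none for topological spaces, being a submersion for manifolds. *)
Record geometry := Geometry {
  geo_space : Type;
  geo_points : geo_space -> topologicalType;
  regular_at : forall X Y : geo_space,
    (geo_points X -> geo_points Y) -> geo_points X -> Prop;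
  admissible : forall X Y : geo_space, (geo_points X -> geo_points Y) -> Prop }.

Coercion geo_points : geo_space >-> topologicalType.

Definition topological : geometry :=
  @Geometry topologicalType id
    (fun X Y f x => {for x, continuous f})
    (fun X Y p => True).

Section ComplexManifolds.
Variable R : realType.

Definition complex_field : numFieldType := Num.NumField.clone R[i]%C _.

Definition complex_space (n : nat) : normedModType complex_field :=
  NormedModule.clone complex_field 'rV[complex_field]_n _.

(** [chart_dim] may vary from chart to chart, so manifolds need not be
    equidimensional. The values of [chart_to] outside [chart_dom] and of
    [chart_from] outside [chart_img] are irrelevant. *)
Record chart (M : topologicalType) := Chart {
  chart_dim : nat;
  chart_dom : set M;
  chart_img : set (complex_space chart_dim);
  chart_to : M -> complex_space chart_dim;
  chart_from : complex_space chart_dim -> M;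
  dom_open : open chart_dom;
  img_open : open chart_img;
  to_img : forall x, chart_dom x -> chart_img (chart_to x);
  from_dom : forall v, chart_img v -> chart_dom (chart_from v);
  toK : forall x, chart_dom x -> chart_from (chart_to x) = x;
  fromK : forall v, chart_img v -> chart_to (chart_from v) = v;
  to_continuous : {within chart_dom, continuous chart_to};
  from_continuous : {within chart_img, continuous chart_from} }.

Arguments chart_to {M} c _ : rename.
Arguments chart_from {M} c _ : rename.

(** Differentiability is over the field [R[i]]; on an open set it amounts to
    holomorphy. *)
Record manifold := Manifold {
  carrier : topologicalType;
  atlas : set (chart carrier);
  carrier_hausdorff : hausdorff_space carrier;
  carrier_second_countable : @second_countable carrier;
  atlas_cover : forall x, exists2 c, atlas c & chart_dom c x;
  atlas_compatible : forall c d, atlas c -> atlas d ->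
    forall x, chart_dom c x -> chart_dom d x ->
    differentiable (chart_to d \o chart_from c) (chart_to c x) }.

Definition holomorphic_at (M N : manifold) (f : carrier M -> carrier N)
    (x : carrier M) : Prop :=
  {for x, continuous f} /\
  forall (c : chart (carrier M)) (d : chart (carrier N)),
    atlas c -> atlas d -> chart_dom c x -> chart_dom d (f x) ->
    differentiable (chart_to d \o f \o chart_from c) (chart_to c x).

Definition submersion (M N : manifold) (f : carrier M -> carrier N) : Prop :=
  forall x, holomorphic_at f x /\
  forall (c : chart (carrier M)) (d : chart (carrier N)),
    atlas c -> atlas d -> chart_dom c x -> chart_dom d (f x) ->
    forall w, exists v,
      'd (chart_to d \o f \o chart_from c) (chart_to c x) v = w.

Definition analytic : geometry :=
  @Geometry manifold carrier holomorphic_at submersion.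

End ComplexManifolds.

(** * Quotient of a type by an equivalence relation *)

(** [T -> Prop] rather than [set T] keeps [T], which may be a type of spaces, free
    of the universe constraints of the library. *)
Definition quotient_by (T : Type) (E : T -> T -> Prop) : Type :=
  {c : T -> Prop | exists t, c = E t}.

Definition class_of (T : Type) (E : T -> T -> Prop) (t : T) : quotient_by E :=
  exist _ (E t) (ex_intro _ t erefl).

Section Torsors.
Variable C : geometry.

Definition regular_on (X Y : geo_space C) (U : set X) (f : X -> Y) : Prop :=
  forall x, U x -> regular_at f x.

Definition regular (X Y : geo_space C) (f : X -> Y) : Prop := regular_on setT f.

Definition is_fibre_product (X P Q F : geo_space C) (p : P -> X) (q : Q -> X)
    (a : F -> P) (b : F -> Q) : Prop :=
  [/\ regular a, regular b, forall z, p (a z) = q (b z) &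
    forall (T : geo_space C) (u : T -> P) (v : T -> Q),
      regular u -> regular v -> (forall t, p (u t) = q (v t)) ->
      exists! w : T -> F,
        regular w /\ forall t, a (w t) = u t /\ b (w t) = v t].

(** The map [(y, z) |-> m y z] is regular on the fibre product of [p] and [q].
    The values of [m] at pairs with [p y <> q z] play no role. *)
Definition regular_on_fibre_product (X P Q Z : geo_space C) (p : P -> X)
    (q : Q -> X) (m : P -> Q -> Z) : Prop :=
  exists (F : geo_space C) (a : F -> P) (b : F -> Q),
    is_fibre_product p q a b /\ regular (fun z : F => m (a z) (b z)).

(** * Group spaces and torsors *)

Record group_space (X : geo_space C) := GroupSpace {
  group_total :> geo_space C;
  gproj : group_total -> X;
  gmul : group_total -> group_total -> group_total;
  ginv : group_total -> group_total;
  gunit : X -> group_total;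
  proj_regular : regular gproj;
  proj_admissible : admissible gproj;
  mul_regular : regular_on_fibre_product gproj gproj gmul;
  inv_regular : regular ginv;
  unit_regular : regular gunit;
  mul_proj : forall g h, gproj g = gproj h -> gproj (gmul g h) = gproj g;
  inv_proj : forall g, gproj (ginv g) = gproj g;
  unit_proj : forall x, gproj (gunit x) = x;
  mul_assoc : forall g h k, gproj g = gproj h -> gproj h = gproj k ->
    gmul g (gmul h k) = gmul (gmul g h) k;
  mul_unit_l : forall g, gmul (gunit (gproj g)) g = g;
  mul_unit_r : forall g, gmul g (gunit (gproj g)) = g;
  mul_inv_l : forall g, gmul (ginv g) g = gunit (gproj g);
  mul_inv_r : forall g, gmul g (ginv g) = gunit (gproj g) }.

Section OverGroupSpace.
Variables (X : geo_space C) (G : group_space X).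

Record right_space := RightSpace {
  rtotal :> geo_space C;
  rproj : rtotal -> X;
  right_act : rtotal -> G -> rtotal;
  rproj_regular : regular rproj;
  act_regular : regular_on_fibre_product rproj (@gproj X G) right_act;
  act_proj : forall y g, rproj y = gproj g -> rproj (right_act y g) = rproj y;
  act_unit : forall y, right_act y (gunit G (rproj y)) = y;
  act_mul : forall y g h, rproj y = gproj g -> gproj g = gproj h ->
    right_act (right_act y g) h = right_act y (gmul g h) }.

Definition is_morphism (P Q : right_space) (f : P -> Q) : Prop :=
  [/\ regular f, forall y, rproj (f y) = rproj y &
    forall y g, rproj y = gproj g -> f (right_act y g) = right_act (f y) g].

Definition isomorphic (P Q : right_space) : Prop :=
  exists (f : P -> Q) (f' : Q -> P),
    [/\ is_morphism f, is_morphism f', cancel f f' & cancel f' f].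

(** [f] and [f'] are mutually inverse isomorphisms between the restrictions to
    [U] of [G], with its right translations, and of [P]. *)
Definition trivialized_on (P : right_space) (U : set X) : Prop :=
  exists (f : G -> P) (f' : P -> G),
    [/\ regular_on (@gproj X G @^-1` U) f /\ regular_on (@rproj P @^-1` U) f',
        forall g, U (gproj g) -> rproj (f g) = gproj g,
        forall y, U (rproj y) -> gproj (f' y) = rproj y,
        (forall g, U (gproj g) -> f' (f g) = g) /\
        (forall y, U (rproj y) -> f (f' y) = y) &
        forall g h, U (gproj g) -> gproj g = gproj h ->
          f (gmul g h) = right_act (f g) h].

Definition is_torsor (P : right_space) : Prop :=
  forall x : X, exists U : set X, [/\ open U, U x & trivialized_on P U].

Definition torsor : Type := {P : right_space | is_torsor P}.

Definition torsor_classes : Type :=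
  quotient_by (fun P Q : torsor => isomorphic (sval P) (sval Q)).

(** * Cech cohomology *)

(** The sheaf of regular sections of [G]; an element stands for its restriction
    to [U]. *)
Definition sections (U : set X) : set (X -> G) :=
  [set s | regular_on U s /\ forall x, U x -> gproj (s x) = x].

Lemma sections_sub (U V : set X) (s : X -> G) :
  V `<=` U -> sections U s -> sections V s.
Proof. by move=> VU [rs ps]; split=> x /VU; [exact: rs | exact: ps]. Qed.

Record open_cover := OpenCover {
  cover_index : Type;
  piece :> cover_index -> set X;
  piece_open : forall i, open (piece i);
  piece_cover : forall x, exists i, piece i x }.

Record cocycle (U : open_cover) := Cocycle {
  cocycle_fun :> cover_index U -> cover_index U -> X -> G;
  cocycle_section : forall i j, sections (U i `&` U j) (cocycle_fun i j);
  cocycle_unit : forall i x, U i x -> cocycle_fun i i x = gunit G x;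
  cocycle_mul : forall i j k x, U i x -> U j x -> U k x ->
    gmul (cocycle_fun i j x) (cocycle_fun j k x) = cocycle_fun i k x }.

Definition cohomologous (U : open_cover) (g h : cocycle U) : Prop :=
  exists u : cover_index U -> X -> G, (forall i, sections (U i) (u i)) /\
    forall i j x, U i x -> U j x ->
      h i j x = gmul (gmul (u i x) (g i j x)) (ginv (u j x)).

Definition H1_cover (U : open_cover) : Type := quotient_by (@cohomologous U).

Definition refines (W U : open_cover)
    (r : cover_index W -> cover_index U) : Prop :=
  forall k, W k `<=` U (r k).

Section Restriction.
Variables (W U : open_cover) (r : cover_index W -> cover_index U).
Hypothesis rP : refines r.

Definition restrict_cocycle (g : cocycle U) : cocycle W :=
  @Cocycle W (fun k l => g (r k) (r l))
    (fun k l => sections_sub (setISS (@rP k) (@rP l))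
                             (cocycle_section g (r k) (r l)))
    (fun k x Wx => cocycle_unit g (rP Wx))
    (fun k l m x Wk Wl Wm => cocycle_mul g (rP Wk) (rP Wl) (rP Wm)).

End Restriction.

(** The restriction map [H1_cover U -> H1_cover W] sends the class of [g] to that
    of [restrict_cocycle rP g]. Two classes are identified in the direct limit
    when they have the same image on some common refinement. *)
Definition same_in_limit (c d : {U : open_cover & H1_cover U}) : Prop :=
  exists (W : open_cover) (r : cover_index W -> cover_index (projT1 c))
    (s : cover_index W -> cover_index (projT1 d))
    (rP : refines r) (sP : refines s)
    (g : cocycle (projT1 c)) (h : cocycle (projT1 d)),
    [/\ projT2 c = class_of (@cohomologous _) g,
        projT2 d = class_of (@cohomologous _) h &
        class_of (@cohomologous W) (restrict_cocycle rP g) =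
        class_of (@cohomologous W) (restrict_cocycle sP h)].

Definition cech_H1 : Type := quotient_by same_in_limit.

End OverGroupSpace.
End Torsors.

(* Main.v *)
From HB Require Import structures.
From mathcomp Require Import all_boot all_order all_algebra.
From mathcomp Require Import all_classical all_reals all_analysis.
Require Import Defs.

(** A trivialized torsor [P] over a cover [U] has trivializations [f_i] from
    [G] to [P], and two of them differ over [U_i] and [U_j] by left translation
    by a section [g_ij] of [G], because an equivariant map of [G] to itself over
    the base is such a translation. The [g_ij] form a cocycle. Say then that
    [g] represents [P]. The theorem follows from three facts about this
    relation.
    - Every torsor is represented by a cocycle ([cocycle_of_torsor]).
    - Every cocycle represents a torsor ([torsor_of_cocycle]).
    - If [g] and [h], on one cover, represent [P] and [Q], then [P] and [Q] are
      isomorphic exactly when [g] and [h] are cohomologous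
      ([isomorphic_cohomologous]): in the trivializations an isomorphism is left
      translation by sections [u_i], and gluing the translations by [u_i] into
      one map asks for [h_ij u_j = u_i g_ij].
    Restricting a cocycle to a finer cover does not change what it represents,
    so on a common refinement the third fact says that the relation identifies
    the equivalence that defines the direct limit with isomorphism of torsors.
    A relation of this kind induces a bijection of quotients
    ([quotient_bijection]).

    Both categories are treated at once. The argument uses only that regularity
    is local, that identities, constants and composites are regular, that
    regular maps are continuous, and that a set covered by open pieces of one
    space, with regular transition maps, becomes a space ([local_geometry]).
    This gluing provides everything that has to be constructed:
    - open subspaces, which turn the universal property of a fibre product, a
      statement on globally defined maps, into a local one ([regular_on_lift]);
      hence products of local sections of [G] are regular ([regular_on_op]);
    - the torsor of a cocycle: once an index [c x] is chosen for each point [x],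
      its underlying set is [G] itself, the element [y] over [x] standing for the
      point whose coordinate in the piece [c x] is [y], and the coordinates in
      the pieces only change the space structure;
    - the fibre product on which the action of the group space on this torsor has
      to be regular, glued from open pieces of the given fibre product of [G]
      with itself ([fibre_product_local]).
    It remains to glue topological spaces, and complex manifolds, where the
    glued space must also be Hausdorff and second countable. *)

Set Implicit Arguments.
Unset Strict Implicit.
Unset Printing Implicit Defensive.

Import Order.TTheory GRing.Theory Num.Theory numFieldNormedType.Exports.

Local Open Scope classical_set_scope.
Local Open Scope ring_scope.

(** * Quotients and choice *)

Lemma sval_inj (T : Type) (P : T -> Prop) : injective (@sval T P).
Proof.
move=> [x Px] [y Py] /= xy; case: _ / xy Py => Py.
by congr exist; exact: Prop_irrelevance.
Qed.

Section QuotientBijection.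
Variables (A B : Type) (E : A -> A -> Prop) (F : B -> B -> Prop).
Variable r : A -> B -> Prop.

Lemma class_ofP (a b : A) : E b b -> class_of E a = class_of E b -> E a b.
Proof. by move=> Ebb /(congr1 sval) /= ->. Qed.

Hypothesis r_total : forall a, exists b, r a b.
Hypothesis r_onto : forall b, exists a, r a b.
Hypothesis rP : forall a b a' b', r a b -> r a' b' -> E a a' <-> F b b'.

Lemma transported_class a b : r a b ->
  (fun b' => exists2 a', E a a' & r a' b') = F b.
Proof.
move=> rab; apply/funext => b'; apply/propext; split=> [[a' Eaa' ra'b']|Fbb'].
  exact/(rP rab ra'b').
by have [a' ra'b'] := r_onto b'; exists a' => //; exact/(rP rab ra'b').
Qed.

Lemma transport_subproof (c : quotient_by E) :
  exists b, (fun b' => exists2 a', sval c a' & r a' b') = F b.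
Proof.
case: c => c [a cE]; have [b rab] := r_total a.
by exists b; rewrite /= cE; exact: transported_class.
Qed.

Definition transport_class (c : quotient_by E) : quotient_by F :=
  exist _ _ (transport_subproof c).

End QuotientBijection.

(** A correspondence, total on both sides, that matches [E] with [F] sends the
    class of [a] to the set of all partners of members of that class, which is the
    class of any partner of [a]. Taking all the partners avoids choosing one. *)
Lemma quotient_bijection (A B : Type) (E : A -> A -> Prop) (F : B -> B -> Prop)
    (r : A -> B -> Prop) :
  (forall a, exists b, r a b) -> (forall b, exists a, r a b) ->
  (forall a b a' b', r a b -> r a' b' -> E a a' <-> F b b') ->
  exists f : quotient_by E -> quotient_by F, bijective f.
Proof.
move=> rt ro rP.
have rP' b a b' a' : r a b -> r a' b' -> F b b' <-> E a a'.
  by move=> h h'; apply: iff_sym; exact: rP.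
exists (transport_class rt ro rP).
exists (@transport_class _ _ F E (fun b a => r a b) ro rt rP').
  move=> [c [a ca]]; apply: sval_inj; rewrite /= ca.
  have [b rab] := rt a; rewrite (transported_class ro rP rab).
  exact: (@transported_class _ _ F E (fun b a => r a b) rt rP').
move=> [c [b cb]]; apply: sval_inj; rewrite /= cb.
have [a rab] := ro b.
rewrite (@transported_class _ _ F E (fun b a => r a b) rt rP' b a rab).
exact: (transported_class ro rP rab).
Qed.

(** A function defined on a part [D] is made total with the default [b]. It is an
    argument of the function because [B] may be empty. *)
Lemma partial_choice (A B : Type) (D : A -> Prop) (r : A -> B -> Prop) :
  (forall x, D x -> exists y, r x y) ->
  exists f : B -> A -> B, forall b x, D x -> r x (f b x).
Proof.
move=> rD; have /choice[f fP] : forall bx : B * A, exists y, D bx.2 -> r bx.2 y.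
  move=> [b x] /=; have [Dx|nDx] := pselect (D x); last by exists b.
  by have [y rxy] := rD x Dx; exists y.
by exists (fun b x => f (b, x)) => b x; exact: (fP (b, x)).
Qed.

(** * Geometries in which pieces can be glued *)

Section LocalGeometry.
Variable C : geometry.

Record local_iso (X P Q : geo_space C) (p : P -> X) (q : Q -> X) (U : set X)
    (f : P -> Q) (f' : Q -> P) : Prop := LocalIso {
  liso_regular : regular_on (p @^-1` U) f;
  liso_inv_regular : regular_on (q @^-1` U) f';
  liso_proj : forall y, U (p y) -> q (f y) = p y;
  liso_inv_proj : forall z, U (q z) -> p (f' z) = q z;
  lisoK : forall y, U (p y) -> f' (f y) = y;
  liso_invK : forall z, U (q z) -> f (f' z) = z }.

(** The set [S], over [X] by [q], is covered by the parts lying over the [U i],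
    each identified by [phi i] and [psi i] with the part of one and the same space
    [Y] over [U i]. The values of [phi i] and [psi i] elsewhere are arbitrary. *)
Record gluing_data (X Y : geo_space C) (p : Y -> X) (S : Type) (q : S -> X)
    (I : Type) (U : I -> set X) (phi : I -> Y -> S) (psi : I -> S -> Y) : Prop :=
  GluingData {
    glue_open : forall i, open (U i);
    glue_cover : forall s, exists i, U i (q s);
    glue_proj : forall i y, U i (p y) -> q (phi i y) = p y;
    glue_inv_proj : forall i s, U i (q s) -> p (psi i s) = q s;
    glueK : forall i y, U i (p y) -> psi i (phi i y) = y;
    glue_invK : forall i s, U i (q s) -> phi i (psi i s) = s;
    glue_transition : forall i j y, U i (p y) -> U j (p y) ->
      regular_at (psi j \o phi i) y }.

(** What the correspondence between torsors and cocycles needs from the category.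
    In [regular_glue] the space has its points in bijection with [S], which avoids
    an equality between types. *)
Record local_geometry : Prop := LocalGeometry {
  regular_id : forall (X : geo_space C) (x : X), regular_at (fun y : X => y) x;
  regular_cst : forall (X Y : geo_space C) (y : Y) (x : X),
    regular_at (fun _ => y) x;
  regular_comp : forall (X Y Z : geo_space C) (f : X -> Y) (g : Y -> Z) (x : X),
    regular_at f x -> regular_at g (f x) -> regular_at (g \o f) x;
  regular_continuous : forall (X Y : geo_space C) (f : X -> Y) (x : X),
    regular_at f x -> {for x, continuous f};
  regular_germ : forall (X Y : geo_space C) (f g : X -> Y) (x : X),
    (\forall y \near x, f y = g y) -> regular_at f x -> regular_at g x;
  regular_glue : forall (X Y : geo_space C) (p : Y -> X) (S : Type) (q : S -> X)
      (I : Type) (U : I -> set X) (phi : I -> Y -> S) (psi : I -> S -> Y),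
    regular p -> gluing_data p q U phi psi ->
    exists (Z : geo_space C) (e : S -> Z) (e' : Z -> S),
      [/\ cancel e e', cancel e' e, regular (q \o e') &
        forall i, local_iso p (q \o e') (U i) (e \o phi i) (psi i \o e')] }.

Hypothesis LC : local_geometry.

Lemma regular_on_comp (X Y Z : geo_space C) (D : set X) (f : X -> Y)
    (g : Y -> Z) :
  regular_on D f -> (forall x, D x -> regular_at g (f x)) ->
  regular_on D (g \o f).
Proof. by move=> rf rg x Dx; apply: (regular_comp LC); [exact: rf|exact: rg]. Qed.

Lemma regular_on_eq (X Y : geo_space C) (D : set X) (f g : X -> Y) : open D ->
  (forall x, D x -> f x = g x) -> regular_on D f -> regular_on D g.
Proof.
move=> oD fg rf x Dx; apply: (regular_germ LC) (rf x Dx).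
by apply: filterS (open_nbhs_nbhs (conj oD Dx)).
Qed.

Lemma regular_onS (X Y : geo_space C) (D E : set X) (f : X -> Y) :
  E `<=` D -> regular_on D f -> regular_on E f.
Proof. by move=> ED rf x /ED; exact: rf. Qed.

Lemma open_preimage (X Y : geo_space C) (p : Y -> X) (U : set X) :
  regular p -> open U -> open (p @^-1` U).
Proof.
move=> rp oU; have /continuousP : continuous p.
  by move=> y; apply: (regular_continuous LC); exact: rp.
exact.
Qed.

(** Existence of [U] as a space, with its inclusion [j] and a retraction [r] of
    [X] that is regular on [U]. Composing with [r] transports regularity on the
    subspace back to [X]. It is the gluing of the single piece [U] of [X], indexed
    by its own points so that every index provides a value for the chart
    outside [U]. *)
Lemma open_subspace (X : geo_space C) (U : set X) : open U ->
  exists (E : geo_space C) (j : E -> X),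
    [/\ regular j, forall t, U (j t) &
      forall x, U x -> exists r : X -> E,
        regular_on U r /\ forall y, U y -> j (r y) = y].
Proof.
move=> oU; pose S := {x : X | U x}.
have [f fP] : exists f : S -> X -> S, forall s x, U x -> sval (f s x) = x.
  apply: (@partial_choice X S U (fun x s => sval s = x)) => x Ux.
  by exists (exist _ x Ux).
have glue : @gluing_data X X id S sval S (fun=> U) f (fun=> sval).
  split=> //.
  - by move=> s; exists s; exact: svalP s.
  - by move=> s t Ut; apply: sval_inj; rewrite fP.
  - move=> s t x Ux _; apply: (@regular_on_eq _ _ U id) (Ux) => //.
      by move=> y Uy /=; rewrite fP.
    by move=> y _; exact: (regular_id LC).
have [E [e [e' [eK e'K rj ej]]]] :=
  regular_glue LC (fun x _ => regular_id LC x) glue.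
exists E, (sval \o e'); split => //.
  by move=> t; exact: svalP (e' t).
move=> x Ux; exists (e \o f (exist _ x Ux)).
have [re _ pe _ _ _] := ej (exist _ x Ux).
by split=> // y Uy; exact: pe.
Qed.

(** * Fibre products *)

Section FibreProduct.
Variables (X P Q F : geo_space C) (p : P -> X) (q : Q -> X).
Variables (a : F -> P) (b : F -> Q).
Hypothesis fp : is_fibre_product p q a b.

(** Constant maps are regular, so the universal property applied to them gives
    existence, and its uniqueness part gives injectivity: a fibre product has the
    expected points. *)
Lemma fibre_product_point y z : p y = q z -> exists t, a t = y /\ b t = z.
Proof.
move=> pq; case: fp => _ _ _ /(_ P (fun=> y) (fun=> z)).
case=> [t _|t _|//|w [[_ wP] _]]; try exact: (regular_cst LC).
by exists (w y); exact: wP.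
Qed.

Lemma fibre_product_inj s t : a s = a t -> b s = b t -> s = t.
Proof.
move=> ast bst; case: fp => ra rb pq /(_ F (fun=> a t) (fun=> b t)).
case=> [u _|u _|//|w [_ wU]]; try exact: (regular_cst LC).
have ws : w = fun=> s by apply: wU; split => [u _|u]; [exact: (regular_cst LC)|].
have : w = fun=> t by apply: wU; split => [u _|u]; [exact: (regular_cst LC)|].
by rewrite ws => /(congr1 (@^~ s)).
Qed.

(** The universal property only speaks of maps defined on a whole space; it is
    applied to the open subspace [D]. *)
Lemma regular_on_lift (T : geo_space C) (D : set T) (w : T -> F) : open D ->
  regular_on D (a \o w) -> regular_on D (b \o w) -> regular_on D w.
Proof.
move=> oD ra rb x Dx; have [E [j [rj jD /(_ x Dx)[r [rr jr]]]]] := open_subspace oD.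
have rwj : regular (w \o j).
  case: (fp) => _ _ pq /(_ E (a \o w \o j) (b \o w \o j)).
  case=> [t _|t _|t|w' [[rw' w'P] _]].
  - by apply: (@regular_comp LC _ _ _ j (a \o w)); [exact: rj|exact: ra].
  - by apply: (@regular_comp LC _ _ _ j (b \o w)); [exact: rj|exact: rb].
  - exact: pq.
  suff -> : w \o j = w' by [].
  by apply/funext => t; have [wa wb] := w'P t; exact: fibre_product_inj.
apply: (@regular_on_eq _ _ D (w \o j \o r)) (Dx) => //.
  by move=> y Dy /=; rewrite jr.
by apply: regular_on_comp => // y Dy; exact: rwj.
Qed.

End FibreProduct.

Lemma regular_on_op (X P Q Z T : geo_space C) (p : P -> X) (q : Q -> X)
    (m : P -> Q -> Z) (D : set T) (u : T -> P) (v : T -> Q) :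
  regular_on_fibre_product p q m -> open D -> regular_on D u ->
  regular_on D v -> (forall t, D t -> p (u t) = q (v t)) ->
  regular_on D (fun t => m (u t) (v t)).
Proof.
move=> [F [a [b [fp rm]]]] oD ru rv uv x Dx.
have [f0 _] := fibre_product_point fp (uv x Dx).
have [w0 w0P] := partial_choice (fun t Dt => fibre_product_point fp (uv t Dt)).
pose w := w0 f0; have wP t : D t -> a (w t) = u t /\ b (w t) = v t by exact: w0P.
apply: (@regular_on_eq _ _ D ((fun f => m (a f) (b f)) \o w)) (Dx) => //.
  by move=> t Dt /=; case: (wP t Dt) => -> ->.
apply: regular_on_comp => [|t Dt]; last exact: rm.
apply: (regular_on_lift fp oD).
- by apply: regular_on_eq ru => // t Dt; case: (wP t Dt).
- by apply: regular_on_eq rv => // t Dt; case: (wP t Dt).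
Qed.

(** Over [U i] the fibre product of [p] and [q] is isomorphic to that of [p0] and
    [q], so it is glued from pieces of the latter. The transition maps are regular
    by [regular_on_lift]. *)
Lemma fibre_product_local (X P0 P Q F : geo_space C) (p0 : P0 -> X)
    (p : P -> X) (q : Q -> X) (a : F -> P0) (b : F -> Q) (I : Type)
    (U : I -> set X) (f : I -> P0 -> P) (f' : I -> P -> P0) :
  regular p0 -> regular p -> regular q -> 
  (forall i, open (U i)) -> (forall x, exists i, U i x) ->
  (forall i, local_iso p0 p (U i) (f i) (f' i)) -> is_fibre_product p0 q a b ->
  exists (F' : geo_space C) (a' : F' -> P) (b' : F' -> Q),
    is_fibre_product p q a' b'.
Proof.
move=> rp0 rp rq oU Ucov fI fp; case: (fp) => ra rb pq _.
pose S := {s : P * Q | p s.1 = q s.2}.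
pose qS (s : S) := q (sval s).2.
have [phi0 phi0P] : exists phi : S -> I * F -> S, forall s iz,
    U iz.1 (p0 (a iz.2)) -> sval (phi s iz) = (f iz.1 (a iz.2), b iz.2).
  apply: (@partial_choice (I * F) S (fun iz => U iz.1 (p0 (a iz.2)))
    (fun iz s => sval s = (f iz.1 (a iz.2), b iz.2))) => -[i z] /= Uz.
  have pf : p (f i (a z)) = q (b z) by rewrite (liso_proj (fI i)).
  by exists (exist _ (f i (a z), b z) pf).
pose phi i s z := phi0 s (i, z).
have phiP i s z : U i (p0 (a z)) -> sval (phi i s z) = (f i (a z), b z).
  exact: phi0P s (i, z).
have liftP i (s : S) : U i (qS s) ->
    exists z, a z = f' i (sval s).1 /\ b z = (sval s).2.
  move=> Us; apply: (fibre_product_point fp).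
  by rewrite (liso_inv_proj (fI i)) (svalP s).
have [psi0 psi0P] := @partial_choice (I * S) F (fun k => U k.1 (qS k.2)) _
  (fun k => @liftP k.1 k.2).
pose psi i z s := psi0 z (i, s).
have psiP i z s : U i (qS s) ->
    a (psi i z s) = f' i (sval s).1 /\ b (psi i z s) = (sval s).2.
  exact: psi0P z (i, s).
(* An index carries a point of [S] and one of [F], as default values. *)
pose K : Type := (I * S * F)%type.
pose UK (k : K) := U k.1.1.
have rpa : regular (p0 \o a).
  by apply: regular_on_comp => // z _; exact: rp0.
have glue : @gluing_data X F (p0 \o a) S qS K UK (fun k => phi k.1.1 k.1.2)
    (fun k => psi k.1.1 k.2).
  split; rewrite /UK.
  - by move=> [[i s] z] /=.
  - move=> s; have [i Ui] := Ucov (qS s).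
    by have [z _] := liftP _ _ Ui; exists (i, s, z).
  - by move=> [[i s] z] y /= Uy; rewrite /qS phiP //= -pq.
  - move=> [[i s] z] t /= Ut; have [-> _] := psiP i z t Ut.
    by rewrite (liso_inv_proj (fI i)) (svalP t).
  - move=> [[i s] z] y /= Uy.
    have Ut : U i (qS (phi i s y)) by rewrite /qS phiP //= -pq.
    have [at_ bt] := psiP i z _ Ut; apply: (fibre_product_inj fp).
      by rewrite at_ phiP //= (lisoK (fI i)).
    by rewrite bt phiP.
  - move=> [[i s] z] t /= Ut; have [at_ bt] := psiP i z t Ut.
    have Uz : U i (p0 (a (psi i z t))).
      by rewrite at_ (liso_inv_proj (fI i)) (svalP t).
    apply: sval_inj; rewrite phiP // at_ bt (liso_invK (fI i)) ?(svalP t) //.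
    by case: (sval t).
  - move=> [[i s] z] [[j s'] z'] y /= Uiy Ujy.
    pose D := (p0 \o a) @^-1` (U i `&` U j).
    have oD : open D by apply: open_preimage => //; exact: openI.
    have Dj t : D t -> U j (qS (phi i s t)).
      by move=> [Dit Djt]; rewrite /qS phiP //= -pq.
    have Df t : D t -> U j (p (f i (a t))).
      by move=> [Dit Djt]; rewrite (liso_proj (fI i)).
    apply: (regular_on_lift fp oD) (conj Uiy Ujy).
      apply: (@regular_on_eq _ _ D (f' j \o (f i \o a))) => // [t Dt /=|].
        by have [-> _] := psiP j z' _ (Dj t Dt); rewrite phiP //; case: Dt.
      apply: regular_on_comp => [|t /Df]; last exact: (liso_inv_regular (fI j)).
      apply: regular_on_comp => [t _|t [Dit _]]; first exact: ra.
      exact: (liso_regular (fI i)).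
    apply: (@regular_on_eq _ _ D b) => // [t Dt /=|t _]; last exact: rb.
    by have [_ ->] := psiP j z' _ (Dj t Dt); rewrite phiP //; case: Dt.
have [Z [e [e' [eK e'K rqS eI]]]] := regular_glue LC rpa glue.
pose D i := (qS \o e') @^-1` U i.
have oD i : open (D i) by exact: open_preimage.
(* A piece that covers a given point of the glued space. *)
have chart_at t : exists k : K, D k.1.1 t.
  have [i Ui] := Ucov (qS (e' t)).
  by have [z _] := liftP _ _ Ui; exists (i, e' t, z).
exists Z, (fun t => (sval (e' t)).1), (fun t => (sval (e' t)).2); split.
- move=> t _; have [[[i s] z] /= Dt] := chart_at t.
  apply: (@regular_on_eq _ _ (D i) (f i \o (a \o (psi i z \o e')))) (Dt) => //
    [u Du /=|].
    have [-> _] := psiP i z _ Du.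
    by rewrite (liso_invK (fI i)) //= (svalP (e' u)).
  apply: regular_on_comp => [|u Du].
    apply: regular_on_comp => [|u Du]; last exact: ra.
    exact: (liso_inv_regular (eI (i, s, z))).
  apply: (liso_regular (fI i)); rewrite /=.
  have [-> _] := psiP i z _ Du.
  by rewrite (liso_inv_proj (fI i)) (svalP (e' u)).
- move=> t _; have [[[i s] z] /= Dt] := chart_at t.
  apply: (@regular_on_eq _ _ (D i) (b \o (psi i z \o e'))) (Dt) => // [u Du /=|].
    by have [_ ->] := psiP i z _ Du.
  apply: regular_on_comp => [|u Du]; last exact: rb.
  exact: (liso_inv_regular (eI (i, s, z))).
- by move=> t; exact: svalP (e' t).
move=> T u v ru rv uv.
pose w0 t : S := exist (fun s => p s.1 = q s.2) (u t, v t) (uv t).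
exists (e \o w0); split; first split.
- move=> t _; have [i Ui] := Ucov (q (v t)).
  have [z0 _] := liftP i (w0 t) Ui.
  pose Dt := (q \o v) @^-1` U i.
  have oDt : open Dt.
    by apply: open_preimage => //; apply: regular_on_comp => // y _; exact: rq.
  have psiw y : Dt y ->
      a (psi i z0 (w0 y)) = f' i (u y) /\ b (psi i z0 (w0 y)) = v y.
    by move=> Dy; exact: psiP i z0 (w0 y) Dy.
  have Upsi y : Dt y -> U i (p0 (a (psi i z0 (w0 y)))).
    move=> Dy; have [-> _] := psiw y Dy.
    by rewrite (liso_inv_proj (fI i)) uv.
  apply: (@regular_on_eq _ _ Dt
    ((e \o phi i (w0 t)) \o (psi i z0 \o w0))) (Ui) => // [y Dy /=|].
    congr e; apply: sval_inj; rewrite phiP; last exact: Upsi.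
    have [-> ->] := psiw y Dy.
    by rewrite (liso_invK (fI i)) // uv.
  apply: regular_on_comp => [|y Dy]; last first.
    exact: (liso_regular (eI (i, w0 t, z0))) (Upsi y Dy).
  apply: (regular_on_lift fp oDt).
    apply: (@regular_on_eq _ _ Dt (f' i \o u)) => // [y Dy /=|].
      by have [-> _] := psiw y Dy.
    apply: regular_on_comp => [y _|y Dy]; first exact: ru.
    by apply: (liso_inv_regular (fI i)); rewrite /= uv.
  apply: (@regular_on_eq _ _ Dt v) => // [y Dy /=|y _]; last exact: rv.
  by have [_ ->] := psiw y Dy.
- by move=> t /=; rewrite eK.
move=> w [_ wP]; apply/funext => t /=; rewrite -[RHS]e'K; congr e.
have [wa wb] := wP t.
by apply: sval_inj; rewrite /= -wa -wb; case: (sval (e' _)).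
Qed.

End LocalGeometry.

(** * The groups on the fibres *)

Section FibreGroup.
Variables (C : geometry) (X : geo_space C) (G : group_space X).
Implicit Types g h y : G.

Lemma gmulKV g y : gproj g = gproj y -> gmul (ginv g) (gmul g y) = y.
Proof. by move=> gy; rewrite mul_assoc ?inv_proj// mul_inv_l gy mul_unit_l. Qed.

Lemma gmulVK g y : gproj g = gproj y -> gmul g (gmul (ginv g) y) = y.
Proof. by move=> gy; rewrite mul_assoc ?inv_proj// mul_inv_r gy mul_unit_l. Qed.

Lemma gmul_gunit g x : gproj g = x -> gmul g (gunit G x) = g.
Proof. by move=> <-; exact: mul_unit_r. Qed.

Lemma conjugate_eq h u g v : gproj h = gproj u -> gproj g = gproj u ->
  gproj v = gproj u ->
  h = gmul (gmul u g) (ginv v) <-> gmul h v = gmul u g.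
Proof.
move=> hu gu vu; have ug : gproj (gmul u g) = gproj u by rewrite mul_proj.
split=> [->|hv].
  by rewrite -mul_assoc ?inv_proj ?ug // mul_inv_l vu -ug mul_unit_r.
by rewrite -hv -mul_assoc ?inv_proj ?hu // mul_inv_r vu -hu mul_unit_r.
Qed.

End FibreGroup.

(** * Cocycles and torsors *)

Section IsomorphicEquivalence.
Variables (C : geometry) (LC : local_geometry C).
Variables (X : geo_space C) (G : group_space X).
Implicit Types P Q R : right_space G.

Lemma is_morphism_id P : is_morphism (fun y : P => y).
Proof. by split=> // x _; exact: (regular_id LC). Qed.

Lemma is_morphism_comp P Q R (f : P -> Q) (g : Q -> R) :
  is_morphism f -> is_morphism g -> is_morphism (g \o f).
Proof.
move=> [rf pf af] [rg pg ag]; split.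
- by apply: (regular_on_comp LC) => // x _; exact: rg.
- by move=> y /=; rewrite pg pf.
- by move=> y h yh /=; rewrite af // ag // pf.
Qed.

Lemma isomorphic_refl P : isomorphic P P.
Proof. by exists id, id; split=> //; exact: is_morphism_id. Qed.

Lemma isomorphic_sym P Q : isomorphic P Q -> isomorphic Q P.
Proof. by move=> [f [f' [? ? ? ?]]]; exists f', f. Qed.

Lemma isomorphic_trans P Q R : isomorphic P Q -> isomorphic Q R -> isomorphic P R.
Proof.
move=> [f [f' [mf mf' fK f'K]]] [g [g' [mg mg' gK g'K]]].
exists (g \o f), (f' \o g'); split; try exact: is_morphism_comp.
- exact: can_comp.
- exact: can_comp.
Qed.

End IsomorphicEquivalence.

Section CocyclesAndTorsors.
Variables (C : geometry) (LC : local_geometry C).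
Variables (X : geo_space C) (G : group_space X).
Implicit Types (P Q : right_space G) (U W : open_cover X).

Definition trivialization P (U : set X) (f : G -> P) (f' : P -> G) : Prop :=
  local_iso (@gproj C X G) (@rproj C X G P) U f f' /\
  forall y h, U (gproj y) -> gproj y = gproj h ->
    f (gmul y h) = right_act (f y) h.

Lemma trivializationP P (U : set X) :
  trivialized_on P U <-> exists f f', @trivialization P U f f'.
Proof.
split=> [[f [f' [[rf rf'] pf pf' [fK f'K] af]]]|].
  by exists f, f'; split.
by move=> [f [f' [[rf rf' pf pf' fK f'K] af]]]; exists f, f'; split.
Qed.

Lemma trivializationS P (U V : set X) (f : G -> P) (f' : P -> G) :
  V `<=` U -> trivialization U f f' -> trivialization V f f'.
Proof.
move=> VU [[rf rf' pf pf' fK f'K] af]; split=> [|y h /VU]; last exact: af.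
split; first [exact: (regular_onS (fun y => VU _) rf)
  | exact: (regular_onS (fun y => VU _) rf') | by move=> y /VU; auto].
Qed.

Lemma triv_inv_equivariant P (U : set X) (f : G -> P) (f' : P -> G) :
  trivialization U f f' -> forall y h, U (rproj y) -> rproj y = gproj h ->
  f' (right_act y h) = gmul (f' y) h.
Proof.
move=> [fI af] y h Uy yh.
have py : gproj (f' y) = gproj h by rewrite (liso_inv_proj fI).
rewrite -{1}(liso_invK fI Uy) -af ?(liso_inv_proj fI) //.
by rewrite (lisoK fI) // mul_proj // (liso_inv_proj fI).
Qed.

Definition represented_by P U (g : cocycle G U) (f : cover_index U -> G -> P)
    (f' : cover_index U -> P -> G) : Prop :=
  (forall i, trivialization (U i) (f i) (f' i)) /\
  forall i j y, U i (gproj y) -> U j (gproj y) ->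
    f j y = f i (gmul (g i j (gproj y)) y).

Definition represents P U (g : cocycle G U) : Prop :=
  exists f f', @represented_by P U g f f'.

Lemma cocycle_proj U (g : cocycle G U) i j x : U i x -> U j x ->
  gproj (g i j x) = x.
Proof. by move=> Ui Uj; have [_ ->] := cocycle_section g i j. Qed.

(** The same relation read in coordinates: over [x], the coordinate [f' j z] is
    changed into [f' i z] by left translation by [g i j x]. *)
Lemma represented_inv P U (g : cocycle G U) f f' :
  @represented_by P U g f f' -> forall i j z, U i (rproj z) -> U j (rproj z) ->
  f' i z = gmul (g i j (rproj z)) (f' j z).
Proof.
move=> [fT fg] i j z Ui Uj.
have [[fIi _] [fIj _]] := (fT i, fT j).
have pz := liso_inv_proj fIj Uj.
rewrite -{1}(liso_invK fIj Uj) (fg i j) pz // (lisoK fIi) //.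
by rewrite mul_proj ?pz ?cocycle_proj.
Qed.

Lemma represents_restrict P U W (r : cover_index W -> cover_index U)
    (rW : refines r) (g : cocycle G U) :
  represents P g -> represents P (restrict_cocycle rW g).
Proof.
move=> [f [f' [fT fg]]]; exists (f \o r), (f' \o r); split=> /= [i|i j y Wi Wj].
  exact: trivializationS (rW i) (fT (r i)).
by apply: fg; exact: rW.
Qed.

(** The torsor has the points of [G]. With [c x] the index chosen for [x], the
    element [y] over [x] has coordinate [g i (c x) x * y] in the piece [i]. The
    transition maps are then the left translations by the [g j i], and commute
    with right translations, so these define the action. *)
Lemma torsor_of_cocycle U (g : cocycle G U) :
  exists P : torsor G, represents (sval P) g.
Proof.
have [c cP] := choice (@piece_cover _ _ U).
have rp := @proj_regular C X G.
pose phi i (y : G) := gmul (g (c (gproj y)) i (gproj y)) y.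
pose psi i (y : G) := gmul (g i (c (gproj y)) (gproj y)) y.
have pphi i y : U i (gproj y) -> gproj (phi i y) = gproj y.
  by move=> Ui; rewrite mul_proj cocycle_proj.
have ppsi i y : U i (gproj y) -> gproj (psi i y) = gproj y.
  by move=> Ui; rewrite mul_proj cocycle_proj.
have psiphi i j y : U i (gproj y) -> U j (gproj y) ->
    psi j (phi i y) = gmul (g j i (gproj y)) y.
  move=> Ui Uj; rewrite /psi pphi // /phi mul_assoc ?cocycle_proj //.
  by rewrite cocycle_mul.
have oU i : open (@gproj C X G @^-1` U i).
  by apply: (open_preimage LC) => //; exact: piece_open.
have glue : gluing_data (@gproj C X G) (@gproj C X G) U phi psi.
  split.
  - exact: piece_open.
  - by move=> s; exact: piece_cover.
  - exact: pphi.
  - exact: ppsi.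
  - by move=> i y Ui; rewrite psiphi // cocycle_unit // mul_unit_l.
  - move=> i y Ui; rewrite /phi ppsi // /psi mul_assoc ?cocycle_proj //.
    by rewrite cocycle_mul // cocycle_unit // mul_unit_l.
  - move=> i j y Ui Uj.
    pose D := @gproj C X G @^-1` (U i `&` U j).
    have oD : open D by rewrite /D preimage_setI; exact: openI.
    apply: (@regular_on_eq _ LC _ _ D
      (fun y => gmul (g j i (gproj y)) y)) (conj Ui Uj) => //.
      by move=> z [Uiz Ujz] /=; rewrite psiphi.
    apply: (regular_on_op LC (@mul_regular C X G) oD).
    + apply: (regular_on_comp LC) => [t _|t [Dit Djt]]; first exact: rp.
      by have [+ _] := cocycle_section g j i; apply; split.
    + by move=> t _; exact: (regular_id LC).
    + by move=> t [Dit Djt]; rewrite cocycle_proj.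
have [Z [e [e' [eK e'K rpZ eI]]]] := regular_glue LC rp glue.
have [F0 [a0 [b0 [fp0 _]]]] := @mul_regular C X G.
have [F [a [b fp]]] := fibre_product_local LC rp rpZ rp (@piece_open _ _ U)
  (@piece_cover _ _ U) eI fp0.
pose act z h := e (gmul (e' z) h).
have ract : regular_on_fibre_product (@gproj C X G \o e') (@gproj C X G) act.
  exists F, a, b; split => // t _; case: (fp) => ra rb ab _.
  have [i Ui] := piece_cover U (gproj (b t)).
  pose D := (@gproj C X G \o b) @^-1` U i.
  have oD : open D.
    apply: (open_preimage LC); last exact: piece_open.
    by apply: (regular_on_comp LC) => // x _; exact: rp.
  have Dp s : D s -> U i (gproj (e' (a s))) by move=> Ds; rewrite [gproj _]ab.
  have pps s : D s -> gproj (psi i (e' (a s))) = gproj (b s).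
    by move=> Ds; rewrite ppsi ?[gproj _]ab.
  (* Right translation computed in the coordinates of the piece [i]. *)
  apply: (@regular_on_eq _ LC _ _ D
    ((e \o phi i) \o (fun s => gmul (psi i (e' (a s))) (b s)))) (Ui) => //.
    move=> s Ds /=; congr e.
    have Ub : U i (gproj (b s)) by exact: Ds.
    rewrite /phi mul_proj ?pps // mul_assoc ?cocycle_proj ?pps //.
    congr gmul; rewrite /psi [gproj (e' _)]ab.
    rewrite mul_assoc ?cocycle_proj ?[gproj (e' _)]ab //.
    rewrite cocycle_mul // cocycle_unit //.
    by rewrite -{1}(ab s) mul_unit_l.
  apply: (regular_on_comp LC) => [|s Ds]; last first.
    apply: (liso_regular (eI i)) => /=.
    by rewrite mul_proj ?pps.
  apply: (regular_on_op LC (@mul_regular C X G) oD) => //.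
    apply: (@regular_on_comp _ LC _ _ _ D a (psi i \o e')) => [s _|s Ds].
      exact: ra.
    by apply: (liso_inv_regular (eI i)) => /=; exact: Dp.
  by move=> s _; exact: rb.
have pact z h : gproj (e' z) = gproj h -> gproj (e' (act z h)) = gproj (e' z).
  by move=> zh; rewrite /act eK mul_proj.
have act1 z : act z (gunit G (gproj (e' z))) = z.
  by rewrite /act mul_unit_r e'K.
have actM z h k : gproj (e' z) = gproj h -> gproj h = gproj k ->
    act (act z h) k = act z (gmul h k).
  by move=> zh hk; rewrite /act eK mul_assoc.
pose P := @RightSpace C X G Z (@gproj C X G \o e') act rpZ ract pact act1 actM.
have fT i : @trivialization P (U i) (e \o phi i) (psi i \o e').
  split; first exact: eI.
  move=> y h Ui yh /=; rewrite /act eK; congr e.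
  by rewrite /phi mul_proj // mul_assoc ?cocycle_proj.
have tP : is_torsor P.
  move=> x; have [i Ui] := piece_cover U x; exists (U i).
  split; [exact: piece_open|by []|].
  by apply/trivializationP; exists (e \o phi i), (psi i \o e').
exists (exist _ P tP), (fun i => e \o phi i), (fun i => psi i \o e'); split=> //.
move=> i j y Ui Uj /=; congr e.
by rewrite /phi mul_proj ?cocycle_proj // mul_assoc ?cocycle_proj // cocycle_mul.
Qed.

(** The cover is indexed by the points of [X], each with a trivialization near it,
    and [g i j x] is the coordinate in the piece [i] of the image of the unit by
    the trivialization [j]. An equivariant map is determined by its values at
    units. *)
Lemma cocycle_of_torsor P : is_torsor P ->
  exists U (g : cocycle G U), represents P g.
Proof.
move=> tP.
have /choice[t tT] : forall x, exists t : set X * (G -> P) * (P -> G),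
    [/\ open t.1.1, t.1.1 x & trivialization t.1.1 t.1.2 t.2].
  move=> x; have [U [oU Ux /trivializationP[f [f' fT]]]] := tP x.
  by exists (U, f, f').
have oU i : open (t i).1.1 by case: (tT i).
have Ucov x : exists i, (t i).1.1 x by exists x; case: (tT x).
pose U := OpenCover oU Ucov.
pose f i := (t i).1.2; pose f' i := (t i).2.
have fT i : trivialization (U i) (f i) (f' i) by case: (tT i).
have fI i := (fT i).1.
pose g i j x := f' i (f j (gunit G x)).
have pf j x : U j x -> rproj (f j (gunit G x)) = x.
  by move=> Uj; rewrite (liso_proj (fI j)) unit_proj.
have gp i j x : U i x -> U j x -> gproj (g i j x) = x.
  by move=> Ui Uj; rewrite (liso_inv_proj (fI i)) pf.
have fg i j x : U i x -> U j x -> f i (g i j x) = f j (gunit G x).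
  by move=> Ui Uj; rewrite (liso_invK (fI i)) ?pf.
have fgM i j y : U i (gproj y) -> U j (gproj y) ->
    f j y = f i (gmul (g i j (gproj y)) y).
  move=> Ui Uj; rewrite (fT i).2 ?gp // fg //.
  by rewrite -(fT j).2 ?unit_proj // mul_unit_l.
have gS i j : sections (U i `&` U j) (g i j).
  split=> [|x [Ui Uj]]; last exact: gp.
  apply: (@regular_on_comp _ LC _ _ _ (U i `&` U j)
    (fun x => f j (gunit G x)) (f' i)).
    apply: (@regular_on_comp _ LC _ _ _ _ (@gunit C X G)) => [x _|x [Ui Uj]].
      exact: unit_regular.
    by apply: (liso_regular (fI j)); rewrite /= unit_proj.
  by move=> x [Ui Uj]; apply: (liso_inv_regular (fI i)); rewrite /= pf.
have g1 i x : U i x -> g i i x = gunit G x.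
  by move=> Ui; rewrite /g (lisoK (fI i)) // unit_proj.
have gM i j k x : U i x -> U j x -> U k x -> gmul (g i j x) (g j k x) = g i k x.
  move=> Ui Uj Uk; rewrite -[LHS](lisoK (fI i)); last by rewrite mul_proj ?gp.
  by rewrite -{1}(gp j k x) // -fgM ?gp // fg.
by exists U, (Cocycle gS g1 gM), f, f'.
Qed.

(** Left translation of the coordinates by [u i] is equivariant for right
    translations, and the relation between [u], [g] and [h] makes these maps agree
    on the overlaps. *)
Lemma twist_morphism P Q U (g h : cocycle G U) f f' k k'
    (u : cover_index U -> X -> G) :
  @represented_by P U g f f' -> @represented_by Q U h k k' ->
  (forall i, sections (U i) (u i)) ->
  (forall i j x, U i x -> U j x ->
    gmul (h i j x) (u j x) = gmul (u i x) (g i j x)) ->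
  exists m : P -> Q, is_morphism m /\
    forall i z, U i (rproj z) -> m z = k i (gmul (u i (rproj z)) (f' i z)).
Proof.
move=> Pg Qh uS hu; have [[fT _] [kT kh]] := (Pg, Qh).
have fI i := (fT i).1; have kI i := (kT i).1.
have [c cP] := choice (@piece_cover _ _ U).
pose m z := k (c (rproj z)) (gmul (u (c (rproj z)) (rproj z)) (f' (c (rproj z)) z)).
have up i x : U i x -> gproj (u i x) = x by case: (uS i) => _; exact.
have ufp i z : U i (rproj z) -> gproj (gmul (u i (rproj z)) (f' i z)) = rproj z.
  by move=> Ui; rewrite mul_proj ?(liso_inv_proj (fI i)) // up.
have mE i z : U i (rproj z) -> m z = k i (gmul (u i (rproj z)) (f' i z)).
  move=> Ui; rewrite /m; set j := c _; have Uj : U j (rproj z) by exact: cP.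
  rewrite (kh i j) ?ufp //; congr k.
  rewrite mul_assoc ?cocycle_proj ?up ?(liso_inv_proj (fI j)) // hu //.
  rewrite -mul_assoc ?cocycle_proj ?up ?(liso_inv_proj (fI j)) //.
  by rewrite -(represented_inv Pg).
have mp z : rproj (m z) = rproj z by rewrite (liso_proj (kI _)) ufp.
exists m; split=> //; split=> //.
- move=> z _; have [i Ui] := piece_cover U (rproj z).
  have oD : open (@rproj C X G P @^-1` U i).
    by apply: (open_preimage LC); [exact: rproj_regular|exact: piece_open].
  apply: (@regular_on_eq _ LC _ _ _
    (k i \o fun z => gmul (u i (rproj z)) (f' i z)) _ oD) (Ui).
    by move=> y Uy /=; rewrite (mE i).
  apply: (regular_on_comp LC) => [|y Uy].
    apply: (regular_on_op LC (@mul_regular C X G) oD).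
    + apply: (regular_on_comp LC) => [t _|t Dt]; first exact: rproj_regular.
      by case: (uS i) => + _; apply.
    + exact: (liso_inv_regular (fI i)).
    + by move=> t Dt; rewrite (liso_inv_proj (fI i)) // up.
  by apply: (liso_regular (kI i)); rewrite /= ufp.
- move=> z y zy; have [i Ui] := piece_cover U (rproj z).
  have Uiy : U i (rproj (right_act z y)) by rewrite act_proj.
  rewrite (mE i) // (mE i) // act_proj // (triv_inv_equivariant (fT i)) //.
  rewrite -(kT i).2 ?ufp // mul_assoc ?up //; rewrite (liso_inv_proj (fI i)) //.
Qed.

(** From an isomorphism [m], the section [u i] is the coordinate of the image by
    [m] of the unit. Conversely [u] twists [P] into [Q], and the inverses of
    the [u i] twist [Q] back into [P]. *)
Lemma isomorphic_cohomologous P Q U (g h : cocycle G U) :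
  represents P g -> represents Q h ->
  (isomorphic P Q <-> cohomologous g h).
Proof.
move=> [f [f' Pg]] [k [k' Qh]]; have [[fT fg] [kT kh]] := (Pg, Qh).
have fI i := (fT i).1; have kI i := (kT i).1.
split=> [[m [m' [[rm pm am] _ mK m'K]]]|[u [uS hu]]].
  pose u i x := k' i (m (f i (gunit G x))).
  have pf i x : U i x -> rproj (m (f i (gunit G x))) = x.
    by move=> Ui; rewrite pm (liso_proj (fI i)) unit_proj.
  have up i x : U i x -> gproj (u i x) = x.
    by move=> Ui; rewrite (liso_inv_proj (kI i)) pf.
  have mf i y : U i (gproj y) -> m (f i y) = k i (gmul (u i (gproj y)) y).
    move=> Ui; rewrite (kT i).2 ?up // (liso_invK (kI i)) ?pf //.
    rewrite -am ?(liso_proj (fI i)) ?unit_proj //.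
    by rewrite -(fT i).2 ?unit_proj // mul_unit_l.
  exists u; split=> [i|i j x Ui Uj].
    split; last exact: up.
    apply: (@regular_on_comp _ LC _ _ _ _ (fun x => m (f i (gunit G x))) (k' i)).
      apply: (@regular_on_comp _ LC _ _ _ _ (fun x => f i (gunit G x)) m).
        apply: (@regular_on_comp _ LC _ _ _ _ (@gunit C X G)) => x Ux.
          exact: unit_regular.
        by apply: (liso_regular (fI i)); rewrite /= unit_proj.
      by move=> x _; exact: rm.
    by move=> x Ux; apply: (liso_inv_regular (kI i)); rewrite /= pf.
  have gp : gproj (g i j x) = x by exact: cocycle_proj.
  have hp : gproj (h i j x) = x by exact: cocycle_proj.
  apply/conjugate_eq; rewrite ?up ?gp ?hp //.
  have : m (f j (gunit G x)) = m (f i (g i j x)).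
    by rewrite (fg i j) unit_proj // gmul_gunit.
  rewrite !mf ?unit_proj ?gp // gmul_gunit ?up // (kh i j) up //.
  move/(congr1 (k' i)); rewrite !(lisoK (kI i)) ?mul_proj ?up ?gp ?hp //.
have up i x : U i x -> gproj (u i x) = x by case: (uS i) => _; exact.
pose v i x := ginv (u i x).
have vp i x : U i x -> gproj (v i x) = x by move=> Ui; rewrite inv_proj up.
have vS i : sections (U i) (v i).
  split; last exact: vp.
  apply: (@regular_on_comp _ LC _ _ _ _ (u i)); first by case: (uS i).
  by move=> x _; exact: inv_regular.
have huE i j x : U i x -> U j x -> gmul (h i j x) (u j x) = gmul (u i x) (g i j x).
  by move=> Ui Uj; apply/conjugate_eq; rewrite ?up ?cocycle_proj //; exact: hu.
have gvE i j x : U i x -> U j x -> gmul (g i j x) (v j x) = gmul (v i x) (h i j x).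
  move=> Ui Uj; rewrite (hu i j x Ui Uj).
  rewrite -mul_assoc ?up ?vp ?mul_proj ?up ?cocycle_proj //.
  by rewrite gmulKV // up // mul_proj cocycle_proj // vp.
have [m [mm mE]] := twist_morphism Pg Qh uS huE.
have [m' [mm' m'E]] := twist_morphism Qh Pg vS gvE.
exists m, m'; split=> // z; have [i Ui] := piece_cover U (rproj z).
  have Um : U i (rproj (m z)) by case: mm => _ ->.
  rewrite (m'E i) //; case: mm => _ mp _; rewrite mp (mE i) //.
  rewrite (lisoK (kI i)) ?mul_proj ?up ?(liso_inv_proj (fI i)) //.
  by rewrite gmulKV ?up ?(liso_inv_proj (fI i)) // (liso_invK (fI i)).
have Um : U i (rproj (m' z)) by case: mm' => _ ->.
rewrite (mE i) //; case: mm' => _ mp _; rewrite mp (m'E i) //.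
rewrite (lisoK (fI i)) ?mul_proj ?vp ?(liso_inv_proj (kI i)) //.
by rewrite gmulVK ?up ?(liso_inv_proj (kI i)) // (liso_invK (kI i)).
Qed.

(** Cohomology of cocycles inherits reflexivity, and the equality of classes, from
    isomorphism of the torsors that they represent. *)
Lemma cohomologous_refl U (g : cocycle G U) : cohomologous g g.
Proof.
have [P Pg] := torsor_of_cocycle g.
exact/(isomorphic_cohomologous Pg Pg)/(isomorphic_refl LC).
Qed.

Lemma cohomologous_class U (g h : cocycle G U) : cohomologous g h ->
  class_of (@cohomologous _ _ _ _) g = class_of (@cohomologous _ _ _ _) h.
Proof.
move=> gh; apply: sval_inj => /=; apply/funext => k; apply/propext.
have [[P Pg] [Q Qh]] := (torsor_of_cocycle g, torsor_of_cocycle h).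
have [R Rk] := torsor_of_cocycle k.
have /(isomorphic_cohomologous Pg Qh) PQ := gh.
split=> [/(isomorphic_cohomologous Pg Rk)|/(isomorphic_cohomologous Qh Rk)] PR.
  apply/(isomorphic_cohomologous Qh Rk).
  exact: (isomorphic_trans LC (isomorphic_sym PQ) PR).
by apply/(isomorphic_cohomologous Pg Rk); exact: (isomorphic_trans LC PQ PR).
Qed.

Lemma common_refinement U W : exists (V : open_cover X)
  (r : cover_index V -> cover_index U) (s : cover_index V -> cover_index W),
  refines r /\ refines s.
Proof.
pose V := @OpenCover C X (cover_index U * cover_index W)
  (fun k => U k.1 `&` W k.2) (fun k => openI (piece_open k.1) (piece_open k.2)).
have Vc x : exists k : cover_index U * cover_index W, (U k.1 `&` W k.2) x.
  by have [[i Ui] [j Wj]] := (piece_cover U x, piece_cover W x); exists (i, j).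
by exists (V Vc), fst, snd; split=> k x [].
Qed.

Definition class_represents (c : {U : open_cover X & H1_cover G U})
    (P : torsor G) : Prop :=
  exists2 g, projT2 c = class_of (@cohomologous _ _ _ _) g & represents (sval P) g.

(** The refinement in [same_in_limit] compares some members of the two classes, not
    the given representatives [g] and [h]: these are exchanged through torsors
    represented by the other members. *)
Lemma same_in_limitP c d (P Q : torsor G) :
  class_represents c P -> class_represents d Q ->
  same_in_limit c d <-> isomorphic (sval P) (sval Q).
Proof.
move=> [g cg Pg] [h dh Qh]; split=> [|PQ].
  move=> [W [r [s [rW [sW [g1 [h1 [cg1 dh1 eqW]]]]]]]].
  have [[P1 P1g] [Q1 Q1h]] := (torsor_of_cocycle g1, torsor_of_cocycle h1).
  have gg1 : cohomologous g g1.
    by apply: class_ofP; [exact: cohomologous_refl|rewrite -cg1].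
  have hh1 : cohomologous h h1.
    by apply: class_ofP; [exact: cohomologous_refl|rewrite -dh1].
  apply: (isomorphic_trans LC).
    exact: (isomorphic_cohomologous Pg P1g).2 gg1.
  apply: (isomorphic_trans LC (Q := sval Q1)); last first.
    exact: (isomorphic_sym ((isomorphic_cohomologous Qh Q1h).2 hh1)).
  apply/(isomorphic_cohomologous (represents_restrict rW P1g)
    (represents_restrict sW Q1h)).
  by apply: class_ofP; [exact: cohomologous_refl|].
have [W [r [s [rW sW]]]] := common_refinement (projT1 c) (projT1 d).
exists W, r, s, rW, sW, g, h; split=> //; apply: cohomologous_class.
exact/(isomorphic_cohomologous (represents_restrict rW Pg)
  (represents_restrict sW Qh)).
Qed.

Theorem cech_H1_torsors : exists f : cech_H1 G -> torsor_classes G, bijective f.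
Proof.
apply: (@quotient_bijection _ _ _ _ class_represents).
- move=> [U [c [g cg]]]; have [P Pg] := torsor_of_cocycle g.
  by exists P, g => //=; exact: sval_inj.
- move=> [P tP]; have [U [g Pg]] := cocycle_of_torsor tP.
  by exists (existT _ U (class_of (@cohomologous _ _ _ _) g)), g.
- by move=> c P d Q cP dQ; exact: same_in_limitP.
Qed.

End CocyclesAndTorsors.

(** * Gluing topological spaces *)

Lemma nbhs_open_sub (T : topologicalType) (x : T) (V : set T) : nbhs x V ->
  exists2 N, open_nbhs x N & N `<=` V.
Proof. by rewrite nbhsE. Qed.

Section GluedTopology.
Variables (X Y : topologicalType) (p : Y -> X) (S : Type) (q : S -> X).
Variables (I : Type) (U : I -> set X) (phi : I -> Y -> S) (psi : I -> S -> Y).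

Definition glued_topology : Type := S.

(** The finest topology for which the charts [phi i] are continuous over [U i]. *)
Definition glued_open (V : set glued_topology) : Prop :=
  forall i, open [set y | U i (p y) /\ V (phi i y)].

Hypothesis glue : @gluing_data topological X Y p S q I U phi psi.
Hypothesis p_continuous : continuous p.

Let open_over i : open (p @^-1` U i).
Proof.
by apply: open_comp => [y _|]; [exact: p_continuous|exact: (glue_open glue)].
Qed.

Let glued_openT : glued_open setT.
Proof.
move=> i; rewrite (_ : [set _ | _] = p @^-1` U i) //.
by apply/seteqP; split=> [y []|y Ui] //; split.
Qed.

Let glued_openI : setI_closed glued_open.
Proof.
move=> V W oV oW i.
rewrite (_ : [set _ | _] = [set y | U i (p y) /\ V (phi i y)] `&`
  [set y | U i (p y) /\ W (phi i y)]); first exact: openI.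
by apply/seteqP; split=> y; [move=> [Ui [Vy Wy]]|move=> [[Ui Vy] [_ Wy]]].
Qed.

Let glued_open_bigU (J : Type) (V : J -> set glued_topology) :
  (forall j, glued_open (V j)) -> glued_open (\bigcup_j V j).
Proof.
move=> oV i; rewrite (_ : [set _ | _] =
  \bigcup_j [set y | U i (p y) /\ V j (phi i y)]).
  by apply: bigcup_open => j _; exact: oV.
apply/seteqP; split=> y; first by move=> [Ui [j _ Vj]]; exists j.
by move=> [j _ [Ui Vj]]; split=> //; exists j.
Qed.

HB.instance Definition _ := gen_eqMixin glued_topology.
HB.instance Definition _ := gen_choiceMixin glued_topology.
HB.instance Definition _ := isOpenTopological.Build glued_topology
  glued_openT glued_openI glued_open_bigU.

Definition glued_space : topologicalType := glued_topology.

Lemma glued_openE (V : set glued_space) : open V =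
  forall i, open [set y | U i (p y) /\ V (phi i y)].
Proof. by []. Qed.

Lemma glued_phi_continuous i y : U i (p y) ->
  {for y, continuous (phi i : Y -> glued_space)}.
Proof.
move=> Ui V /nbhs_open_sub[N [oO Oy] OV].
have : nbhs y [set z | U i (p z) /\ N (phi i z)].
  by apply: open_nbhs_nbhs; split=> //; exact: oO.
by apply: filterS => z [_ /OV].
Qed.

(** This is where continuity of the transition maps enters: it makes the [phi i]
    open maps over [U i]. *)
Lemma glued_psi_open i (V : set Y) : open V ->
  open [set s : glued_space | U i (q s) /\ V (psi i s)].
Proof.
rewrite glued_openE => oV j; rewrite openE => y [Uj [Ui Vy]].
move: Ui; rewrite (glue_proj glue) // => Ui.
have tc : {for y, continuous (psi i \o phi j)} := glue_transition glue Uj Ui.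
have [oUi oUj] := (open_over i, open_over j).
apply: filterS (filterI (open_nbhs_nbhs (conj oUi Ui))
 (filterI (open_nbhs_nbhs (conj oUj Uj)) (tc _ (open_nbhs_nbhs (conj oV Vy))))).
by move=> z /= [Uiz [Ujz Vz]]; rewrite (glue_proj glue).
Qed.

Lemma glued_open_over i : open [set s : glued_space | U i (q s)].
Proof.
rewrite (_ : [set _ | _] = [set s | U i (q s) /\ setT (psi i s)]).
  exact/glued_psi_open/openT.
by apply/seteqP; split=> s => [Us|[]].
Qed.

Lemma glued_psi_continuous i (s : glued_space) : U i (q s) ->
  {for s, continuous (psi i : glued_space -> Y)}.
Proof.
move=> Ui V /nbhs_open_sub[N [oO Os] OV].
have : nbhs s [set z | U i (q z) /\ N (psi i z)].
  by apply: open_nbhs_nbhs; split=> //; exact: glued_psi_open.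
by apply: filterS => z [_ /OV].
Qed.

Lemma glued_proj_continuous : continuous (q : glued_space -> X).
Proof.
move=> s; have [i Ui] := glue_cover glue s.
move=> V qV.
have cpp : {for s, continuous (p \o (psi i : glued_space -> Y))}.
  exact: continuous_comp (glued_psi_continuous Ui) (@p_continuous _).
have /= pE := glue_inv_proj glue.
have pV : nbhs (p (psi i s)) V by rewrite pE.
apply: filterS (filterI (open_nbhs_nbhs (conj (glued_open_over i) Ui)) (cpp _ pV)).
by move=> t /= [Ut]; rewrite pE.
Qed.

(** Points over distinct points of [X] are separated by open sets of [X]; points
    over the same one lie in a common piece, a copy of an open part of [Y]. *)
Lemma glued_hausdorff : hausdorff_space X -> hausdorff_space Y ->
  hausdorff_space glued_space.
Proof.
rewrite !open_hausdorff => hX hY s t st.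
have [qst|qst] := eqVneq (q s) (q t); last first.
  have [[A B] [/= As Bt] [oA oB /eqP AB0]] := hX _ _ qst.
  have oq := proj1 (@continuousP glued_space X q) glued_proj_continuous.
  exists (q @^-1` A, q @^-1` B); first by rewrite !inE in As Bt *.
  split; [exact: oq|exact: oq|].
  by apply/eqP; rewrite /= -preimage_setI AB0 preimage_set0.
have [i Us] := glue_cover glue s; have Ut : U i (q t) by rewrite -qst.
have pst : psi i s != psi i t.
  apply/eqP => /(congr1 (phi i)); rewrite !(glue_invK glue) // => e.
  by rewrite e eqxx in st.
have [[A B] [/= As Bt] [oA oB /eqP AB0]] := hY _ _ pst.
exists ([set z | U i (q z) /\ A (psi i z)], [set z | U i (q z) /\ B (psi i z)]).
  by rewrite !inE in As Bt *.
split; [exact: glued_psi_open|exact: glued_psi_open|].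
apply/eqP/seteqP; split=> // z [/= [_ Az] [_ Bz]].
by have : (A `&` B) (psi i z) by []; rewrite AB0.
Qed.

(** The family [U] may be uncountable. The members of a countable basis of [X]
    that are contained in some [U i] are enough to reach every point of [S], and
    one index [c A] is chosen for each of them. Products of such an [A] with a
    member of a basis of [Y], read in the piece [c A], form a countable basis. *)
Lemma glued_second_countable : @second_countable X -> @second_countable Y ->
  @second_countable glued_space.
Proof.
move=> [BX cX [BXo BXb]] [BY cY [BYo BYb]].
pose good (A : set X) := BX A /\ exists i, A `<=` U i.
have [I0|nI] := pselect (inhabited I); last first.
  exists set0; first exact: countable0.
  split=> // s; have [i _] := glue_cover glue s.
  by case: nI.
have [c cP] : exists c : set X -> I, forall A, good A -> A `<=` U (c A).
  have /choice[c cP] : forall A, exists i, good A -> A `<=` U i.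
    move=> A; have [[_ [i Ai]]|nA] := pselect (good A); first by exists i.
    by case: I0 => i; exists i.
  by exists c.
pose piece (AB : set X * set Y) : set glued_space :=
  [set s | AB.1 (q s) /\ AB.2 (psi (c AB.1) s)].
exists (piece @` (good `*` BY)).
  apply: (sub_countable (card_image_le _ _)); apply: countableX => //.
  by apply: (sub_countable _ cX); apply: subset_card_le => A [].
split.
  move=> _ [[A B] [/= gA bB] <-].
  have oq := proj1 (@continuousP glued_space X q) glued_proj_continuous.
  rewrite (_ : piece _ = q @^-1` A `&`
    [set s | U (c A) (q s) /\ B (psi (c A) s)]).
    apply: openI; first by apply: oq; apply: BXo; case: gA.
    by apply: glued_psi_open; exact: BYo.
  apply/seteqP; split=> s /= [As]; last by case.
  by move=> Bs; split=> //; split=> //; exact: cP As.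
move=> s V /nbhs_open_sub[N [oO Os] OV].
have [i Ui] := glue_cover glue s.
have /BXb[A [bA Aq] AU] : nbhs (q s) (U i).
  by apply: open_nbhs_nbhs; split=> //; exact: (glue_open glue).
have gA : good A by split=> //; exists i.
have Uc : U (c A) (q s) by exact: cP Aq.
have := oO (c A); move=> oW.
have /BYb[B [bB Bs] BW] : nbhs (psi (c A) s)
    [set y | U (c A) (p y) /\ N (phi (c A) y)].
  apply: open_nbhs_nbhs; split=> //=.
  by rewrite (glue_inv_proj glue) // (glue_invK glue).
exists (piece (A, B)) => /=; first by split=> //; exists (A, B).
move=> t [/= At Bt]; apply: OV.
have [_] := BW _ Bt; rewrite (glue_invK glue) //.
exact: cP At.
Qed.

End GluedTopology.

Lemma topological_local : local_geometry topological.
Proof.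
split.
- by move=> X x; exact: cvg_id.
- by move=> X Y y x; exact: cvg_cst.
- by move=> X Y Z f g x cf cg; exact: continuous_comp.
- by [].
- move=> X Y f g x fg cf V gV.
  have fV : nbhs (f x) V by rewrite [f x](nbhs_singleton fg).
  by apply: filterS (filterI fg (cf _ fV)) => y [/= <-].
- move=> X Y p S q I U phi psi rp glue.
  have cp : continuous p by move=> y; exact: rp.
  exists (glued_space glue cp), id, id; split=> //.
    by move=> y _; exact: glued_proj_continuous.
  move=> i; split.
  + by move=> y Uy; exact: glued_phi_continuous.
  + by move=> s Us; exact: glued_psi_continuous.
  + exact: (glue_proj glue).
  + exact: (glue_inv_proj glue).
  + exact: (glueK glue).
  + exact: (glue_invK glue).
Qed.

(** * Gluing complex manifolds *)

Lemma differentiable_germ (K : numFieldType) (V W : normedModType K)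
    (f g : V -> W) (x : V) :
  (\forall y \near x, f y = g y) -> differentiable f x -> differentiable g x.
Proof.
move=> fg df; have fgx : f x = g x := nbhs_singleton fg.
have expand : g \o shift x = cst (g x) + 'd f x +o_ 0 id.
  apply/eqaddoP => eps eps0; have /eqaddoP/(_ _ eps0) := diff_locally df.
  move: fg; rewrite (near_shift 0) subr0 => fg small.
  by apply: filterS (filterI fg small) => h [/= fgh]; rewrite !fctE /= fgh fgx.
have dfg : 'd g x = 'd f x :> (V -> W).
  by apply: diff_unique expand; exact: diff_continuous.
by apply/diff_locallyP; rewrite dfg; split; first exact: diff_continuous.
Qed.

Arguments chart_from {R M} c _ : rename.
Arguments chart_img {R M} c _ : rename.

Section Holomorphic.
Variable R : realType.

Lemma chart_to_continuous_at (M : topologicalType) (c : chart R M) x :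
  chart_dom c x -> {for x, continuous (chart_to c)}.
Proof.
move=> cx; have := @to_continuous R M c.
rewrite continuous_open_subspace; last exact: dom_open.
by apply; rewrite inE.
Qed.

Lemma chart_from_continuous_at (M : topologicalType) (c : chart R M) v :
  chart_img c v -> {for v, continuous (chart_from c)}.
Proof.
move=> cv; have := @from_continuous R M c.
rewrite continuous_open_subspace; last exact: img_open.
by apply; rewrite inE.
Qed.

Lemma near_chart_from (M : topologicalType) (c : chart R M) x (V : set M) :
  chart_dom c x -> nbhs x V -> \forall v \near chart_to c x, V (chart_from c v).
Proof.
move=> cx Vx; apply: (chart_from_continuous_at (to_img cx)).
by rewrite toK.
Qed.

Lemma holomorphic_id (M : manifold R) (x : carrier M) :
  @holomorphic_at R M M (fun y => y) x.
Proof.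
by split=> [|c d Ac Ad cx dx]; [exact: cvg_id|exact: atlas_compatible].
Qed.

Lemma holomorphic_cst (M N : manifold R) (y : carrier N) (x : carrier M) :
  @holomorphic_at R M N (fun=> y) x.
Proof.
by split=> [|c d Ac Ad cx dx]; [exact: cvg_cst|exact: differentiable_cst].
Qed.

Lemma holomorphic_germ (M N : manifold R) (f g : carrier M -> carrier N) x :
  (\forall y \near x, f y = g y) -> holomorphic_at f x -> holomorphic_at g x.
Proof.
move=> fg [cf df]; have fgx : f x = g x := nbhs_singleton fg.
split; first exact: (regular_germ topological_local) fg cf.
move=> c d Ac Ad cx dx; rewrite -fgx in dx.
apply: differentiable_germ (df c d Ac Ad cx dx).
by apply: filterS (near_chart_from cx fg) => v /= ->.
Qed.

(** The chain rule through a chart [d] at [f x]. The composite with the change of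
    coordinates [d] agrees with the wanted map only near the point, where [f]
    stays in the domain of [d]. *)
Lemma holomorphic_comp (M N L : manifold R) (f : carrier M -> carrier N)
    (g : carrier N -> carrier L) x :
  holomorphic_at f x -> holomorphic_at g (f x) -> holomorphic_at (g \o f) x.
Proof.
move=> [cf df] [cg dg]; split; first exact: continuous_comp.
move=> c e Ac Ae cx ex; have [d Ad dx] := atlas_cover (f x).
have dN : nbhs (f x) (chart_dom d).
  by apply: open_nbhs_nbhs; split=> //; exact: dom_open.
apply: (@differentiable_germ _ _ _
  ((chart_to e \o g \o chart_from d) \o (chart_to d \o f \o chart_from c))).
  by apply: filterS (near_chart_from cx (cf _ dN)) => v /= dv; rewrite toK.
apply: differentiable_comp; first exact: df.
by rewrite /= toK //; exact: dg.
Qed.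

Section GluedManifold.
Variables (X Y : manifold R) (p : carrier Y -> carrier X).
Variables (S : Type) (q : S -> carrier X) (I : Type) (U : I -> set (carrier X)).
Variables (phi : I -> carrier Y -> S) (psi : I -> S -> carrier Y).
Hypothesis p_holomorphic : forall y, holomorphic_at p y.
Hypothesis glue : @gluing_data (analytic R) X Y p S q I U phi psi.

Lemma glue_topological :
  @gluing_data topological (carrier X) (carrier Y) p S q I U phi psi.
Proof.
case: glue => oU cU pp ip K iK tr; split=> // i j y Ui Uj.
by case: (tr i j y Ui Uj).
Qed.

Lemma base_map_continuous : continuous p.
Proof. by move=> y; case: (p_holomorphic y). Qed.

Let Z := glued_space glue_topological base_map_continuous.

(** The charts of the glued manifold are the charts [c] of [Y] seen in a piece
    [i]; their changes of coordinates are the transition maps of the gluing, read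
    in charts of [Y]. *)
Section Chart.
Variables (c : chart R (carrier Y)) (i : I).

Let Zdom : set Z := [set s | U i (q s) /\ chart_dom c (psi i s)].
Let Zimg : set (complex_space R (chart_dim c)) :=
  [set v | chart_img c v /\ U i (p (chart_from c v))].

Let Zdom_open : open Zdom.
Proof. exact/glued_psi_open/dom_open. Qed.

Let Zimg_open : open Zimg.
Proof.
rewrite openE => v [cv Uv].
have oV : open (p @^-1` U i).
  apply: open_comp => [y _|]; first exact: base_map_continuous.
  exact: (glue_open glue).
apply: filterS (filterI (open_nbhs_nbhs (conj (img_open (c := c)) cv))
  (chart_from_continuous_at cv (open_nbhs_nbhs (conj oV Uv)))).
by move=> w [].
Qed.

Let Zto_img s : Zdom s -> Zimg (chart_to c (psi i s)).
Proof.
move=> [Us cs]; split; first exact: to_img.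
by rewrite toK // (glue_inv_proj glue).
Qed.

Let Zfrom_dom v : Zimg v -> Zdom (phi i (chart_from c v)).
Proof.
move=> [cv Uv]; split; first by rewrite (glue_proj glue).
by rewrite (glueK glue) //; exact: from_dom.
Qed.

Let ZtoK s : Zdom s -> phi i (chart_from c (chart_to c (psi i s))) = s.
Proof. by move=> [Us cs]; rewrite toK // (glue_invK glue). Qed.

Let ZfromK v : Zimg v -> chart_to c (psi i (phi i (chart_from c v))) = v.
Proof. by move=> [cv Uv]; rewrite (glueK glue) // fromK. Qed.

Let Zto_continuous : {within Zdom, continuous (chart_to c \o psi i : Z -> _)}.
Proof.
rewrite continuous_open_subspace // => s; rewrite inE => -[Us cs].
apply: continuous_comp; first exact: glued_psi_continuous.
exact: chart_to_continuous_at.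
Qed.

Let Zfrom_continuous : {within Zimg, continuous (phi i \o chart_from c : _ -> Z)}.
Proof.
rewrite continuous_open_subspace // => v; rewrite inE => -[cv Uv].
apply: continuous_comp; first exact: chart_from_continuous_at.
exact: glued_phi_continuous.
Qed.

Definition glued_chart : chart R Z :=
  @Chart R Z (chart_dim c) Zdom Zimg (chart_to c \o psi i)
    (phi i \o chart_from c) Zdom_open Zimg_open Zto_img Zfrom_dom ZtoK ZfromK
    Zto_continuous Zfrom_continuous.

End Chart.

Definition glued_atlas : set (chart R Z) :=
  [set k | exists c i, atlas c /\ k = glued_chart c i].

Lemma glued_atlas_cover (s : Z) : exists2 k, glued_atlas k & chart_dom k s.
Proof.
have [i Us] := glue_cover glue s; have [c Ac cs] := atlas_cover (psi i s).
by exists (glued_chart c i); first by exists c, i.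
Qed.

Lemma glued_atlas_compatible k l : glued_atlas k -> glued_atlas l ->
  forall s, chart_dom k s -> chart_dom l s ->
  differentiable (chart_to l \o chart_from k) (chart_to k s).
Proof.
move=> [c [i [Ac ->]]] [d [j [Ad ->]]] s [Ui cs] [Uj ds].
have pE := glue_inv_proj glue Ui.
have [||_ tr] := @glue_transition _ _ _ _ _ _ _ _ _ _ glue i j (psi i s);
  rewrite ?pE //.
by apply: (tr c d Ac Ad cs); rewrite /= (glue_invK glue).
Qed.

Definition glued_manifold : manifold R :=
  @Manifold R Z glued_atlas
    (glued_hausdorff (@carrier_hausdorff R X) (@carrier_hausdorff R Y))
    (glued_second_countable glue_topological base_map_continuous
      (@carrier_second_countable R X) (@carrier_second_countable R Y))
    glued_atlas_cover glued_atlas_compatible.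

Lemma glued_phi_holomorphic i y : U i (p y) ->
  @holomorphic_at R Y glued_manifold (phi i) y.
Proof.
move=> Ui; split; first exact: glued_phi_continuous.
move=> c k Ac [d [j [Ad ->]]] cy [Uj dy].
rewrite (glue_proj glue) // in Uj.
by have [_ tr] := glue_transition glue Ui Uj; exact: tr.
Qed.

Lemma glued_psi_holomorphic i (s : Z) : U i (q s) ->
  @holomorphic_at R glued_manifold Y (psi i) s.
Proof.
move=> Ui; split; first exact: glued_psi_continuous.
move=> k d [c [j [Ac ->]]] Ad [Uj cs] ds.
have pE := glue_inv_proj glue Uj.
have [||_ tr] := @glue_transition _ _ _ _ _ _ _ _ _ _ glue j i (psi j s);
  rewrite ?pE //.
by apply: (tr c d Ac Ad cs); rewrite /= (glue_invK glue).
Qed.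

Lemma glued_proj_holomorphic (s : Z) : @holomorphic_at R glued_manifold X q s.
Proof.
have [i Us] := glue_cover glue s.
apply: (@holomorphic_germ glued_manifold X (p \o psi i)).
  apply: filterS (open_nbhs_nbhs (conj
    (glued_open_over glue_topological base_map_continuous i) Us)) => t Ut.
  exact: (glue_inv_proj glue).
by apply: holomorphic_comp; [exact: glued_psi_holomorphic|exact: p_holomorphic].
Qed.

End GluedManifold.

Lemma analytic_local : local_geometry (analytic R).
Proof.
split.
- exact: holomorphic_id.
- exact: holomorphic_cst.
- exact: holomorphic_comp.
- by move=> X Y f x [].
- exact: holomorphic_germ.
- move=> X Y p S q I U phi psi rp glue.
  have hp y : holomorphic_at p y by exact: rp.
  exists (glued_manifold hp glue), id, id; split=> //.
    by move=> y _; exact: glued_proj_holomorphic.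
  move=> i; split.
  + by move=> y Uy; exact: glued_phi_holomorphic.
  + by move=> s Us; exact: glued_psi_holomorphic.
  + exact: (glue_proj glue).
  + exact: (glue_inv_proj glue).
  + exact: (glueK glue).
  + exact: (glue_invK glue).
Qed.

End Holomorphic.

Theorem theorem3p11 :
  (forall (X : geo_space topological) (G : group_space X),
     exists f : cech_H1 G -> torsor_classes G, bijective f) /\
  (forall (R : realType) (X : geo_space (analytic R)) (G : group_space X),
     exists f : cech_H1 G -> torsor_classes G, bijective f).
Proof.
split=> [X G|R X G]; apply: cech_H1_torsors.
- exact: topological_local.
- exact: analytic_local.
Qed.
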